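(* Let $R$ be a commutative ring with $1 \neq 0$ that is a semi-field. Then $R$ has property $( * )$; that is, for every surjective ring homomorphism $\varphi : R \twoheadrightarrow S$ (for any ring $S$), the induced group homomorphism $\varphi^\times : R^\times \to S^\times$ on unit groups is surjective.
   Context: All rings are commutative with $1 \neq 0$. $\operatorname{rad}(R)$ denotes the Jacobson radical of $R$ (the intersection of all maximal ideals), and $\operatorname{mSpec}(R)$ the set of maximal ideals. For $r \in R$, a subset $S \subseteq R$ is called a semi-inverse set for $r$ if for every $\mathfrak{m} \in \operatorname{mSpec}(R)$, either $r \in \mathfrak{m}$ or there exists $s \in S$ with $1 - sr \in \mathfrak{m}$. Let $\rho(r) \in \mathbb{N} \cup \{\infty\}$ be the minimum cardinality of a finite semi-inverse set for $r$ if one exists, and $\rho(r) = \infty$ otherwise. The element $r$ is called a semi-unit if $\rho(r) = 1$. The ring $R$ is called a semi-field if every element of $R$ is either a semi-unit or in $\operatorname{rad}(R)$, i.e. $\rho(R) \subseteq \{0,1\}$. *)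

(* Defs.v *)
From mathcomp Require Import all_boot all_order all_algebra.
From mathcomp Require Import boolp classical_sets functions cardinality.

Set Implicit Arguments.
Unset Strict Implicit.
Unset Printing Implicit Defensive.

Import GRing.Theory.

Local Open Scope classical_set_scope.
Local Open Scope card_scope.
Local Open Scope ring_scope.

(* idealr_closed requires 1 \notin I, so these are the proper ideals. *)
Definition proper_ideal_set (R : comNzRingType) (I : set R) : Prop :=
  idealr_closed [in I].

Lemma proper_ideal_setE (R : comNzRingType) (I : set R) :
  proper_ideal_set I <->
  [/\ I 0, ~ I 1 & forall a u v, I u -> I v -> I (a * u + v)].
Proof.
split=> -[I0 I1 IM]; split.
- exact: set_mem I0.
- by move=> /mem_set; apply/negP.
- by move=> a u v /mem_set Iu /mem_set Iv; exact/set_mem/IM.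
- exact: mem_set.
- by apply/negP => /set_mem.
- by move=> a u v /set_mem Iu /set_mem Iv; exact/mem_set/IM.
Qed.

Definition mSpec (R : comNzRingType) : set (set R) :=
  [set m : set R | proper_ideal_set m
    /\ forall I : set R, proper_ideal_set I -> m `<=` I -> I = m].
Arguments mSpec : clear implicits.

Definition jacobson_rad (R : comNzRingType) : set R := \bigcap_(m in mSpec R) m.
Arguments jacobson_rad : clear implicits.

Definition semi_inverse_set (R : comNzRingType) (r : R) (S : set R) : Prop :=
  forall m : set R, mSpec R m -> m r \/ exists2 s, S s & m (1 - s * r).

Definition has_semi_inverse_set (R : comNzRingType) (r : R) (n : nat) : Prop :=
  exists S : set R, semi_inverse_set r S /\ S #= `I_n.

Lemma has_semi_inverse_setW (R : comNzRingType) (r : R) :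
  (exists n, has_semi_inverse_set r n) ->
  exists n, `[< has_semi_inverse_set r n >].
Proof. by case=> n rn; exists n; apply/asboolP. Qed.

(* None stands for infinity. *)
Definition rho (R : comNzRingType) (r : R) : option nat :=
  if pselect (exists n, has_semi_inverse_set r n) is left exn
  then Some (ex_minn (has_semi_inverse_setW exn)) else None.

Lemma rho_SomeP (R : comNzRingType) (r : R) (n : nat) :
  rho r = Some n <->
  has_semi_inverse_set r n
    /\ forall k, has_semi_inverse_set r k -> (n <= k)%N.
Proof.
rewrite /rho; case: pselect => [exn|noex]; last first.
  by split=> // -[rn _]; case: noex; exists n.
case: ex_minnP => m /asboolP rm mmin; split=> [[<-]|[rn nmin]].
  by split=> // k rk; apply/mmin/asboolP.
congr Some; apply/eqP; rewrite eqn_leq (nmin _ rm) andbT.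
exact/mmin/asboolP.
Qed.

Lemma rho_NoneP (R : comNzRingType) (r : R) :
  rho r = None <-> forall n, ~ has_semi_inverse_set r n.
Proof.
rewrite /rho; case: pselect => [[n rn]|noex]; split=> //.
- by move=> /(_ n).
- by move=> _ n rn; apply: noex; exists n.
Qed.

Definition semi_unit (R : comNzRingType) (r : R) : Prop := rho r = Some 1%N.

Definition semi_field (R : comNzRingType) : Prop :=
  forall r : R, semi_unit r \/ jacobson_rad R r.

(* GRing.unit needs a chosen inverse function, which an arbitrary commutative
   ring does not carry; the two notions agree when it does (unitsE). *)
Definition units (R : comNzRingType) : set R :=
  [set u | exists v, v * u = 1].
Arguments units : clear implicits.

Lemma unitsE (R : comUnitRingType) : units R = [set` @GRing.unit R].
Proof.
apply/seteqP; split=> u /=.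
  by case=> v vu; apply/unitrP; exists v; rewrite [u * v]mulrC.
by move=> uu; exists u^-1; rewrite mulVr.
Qed.

(* The induced map of unit groups is the restriction of phi to the units. *)
Definition property_star (R : comNzRingType) : Prop :=
  forall (S : comNzRingType) (phi : {rmorphism R -> S}),
    set_surj [set: R] [set: S] phi -> set_surj (units R) (units S) phi.

(* Main.v *)
Require Import Defs.
From mathcomp Require Import all_boot all_algebra.
From mathcomp Require Import boolp classical_sets functions cardinality.
From mathcomp Require Import ring.

(** Let [u] be a unit of [S] with inverse [v], and lift [u], [v] to [r], [t]
    in [R].  There is [s] such that every maximal ideal contains [r] or
    [1 - s r].  Then [w = r + (1 - s r)(1 - r t)] lifts [u], because [1 - r t]
    is in the kernel.  Moreover [w] is in no maximal ideal [m], hence is a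
    unit: if [m] contains [r] then [w = 1] mod [m], and if [m] contains
    [1 - s r] then [w = r] mod [m], where [r] is invertible mod [m]. *)

Import GRing.Theory.

Local Open Scope classical_set_scope.
Local Open Scope ring_scope.

Section ProperIdeals.
Variables (R : comNzRingType) (I : set R).
Hypothesis properI : proper_ideal_set I.

Lemma proper_ideal0 : I 0.
Proof. by case/proper_ideal_setE: properI. Qed.

Lemma proper_ideal_not1 : ~ I 1.
Proof. by case/proper_ideal_setE: properI. Qed.

Lemma proper_idealM a u : I u -> I (a * u).
Proof.
by case/proper_ideal_setE: properI => I0 _ IM Iu; rewrite -[_ * _]addr0; exact: IM.
Qed.

Lemma proper_idealD u v : I u -> I v -> I (u + v).
Proof.
by case/proper_ideal_setE: properI => _ _ IM Iu Iv; rewrite -[u]mul1r; exact: IM.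
Qed.

End ProperIdeals.

Lemma principal_proper (R : comNzRingType) (x : R) :
  ~ units R x -> proper_ideal_set [set a * x | a in [set: R]].
Proof.
move=> nx; apply/proper_ideal_setE; split.
- by exists 0 => //; rewrite mul0r.
- by case=> a _ ax; apply: nx; exists a.
- move=> a _ _ [b _ <-] [c _ <-]; exists (a * b + c) => //.
  by rewrite mulrDl mulrA.
Qed.

(** Totality puts any two elements of the union in a common member of [F]; [F] must be nonempty for
    the union to contain 0. *)
Lemma bigcup_chain_proper (R : comNzRingType) (F : set (set R)) :
  F !=set0 -> (forall I, F I -> proper_ideal_set I) -> total_on F subset ->
  proper_ideal_set (\bigcup_(I in F) I).
Proof.
move=> [I FI] Fprop Ftot; apply/proper_ideal_setE; split.
- by exists I => //; exact: proper_ideal0 (Fprop _ FI).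
- by case=> J FJ; exact: proper_ideal_not1 (Fprop _ FJ).
- move=> a u v [J FJ Ju] [K FK Kv].
  have [JK|KJ] := Ftot J K FJ FK.
    exists K => //; apply: (proper_idealD _ _ (Fprop _ FK)) => //.
    exact/(proper_idealM _ _ (Fprop _ FK))/JK.
  exists J => //; apply: (proper_idealD _ _ (Fprop _ FJ)); last exact: KJ.
  exact: (proper_idealM _ _ (Fprop _ FJ)).
Qed.

Lemma exists_maximal_ideal (R : comNzRingType) (I : set R) :
  proper_ideal_set I -> exists2 m, mSpec R m & I `<=` m.
Proof.
move=> properI.
(* The empty set is admitted because [Zorn_bigcup] covers the empty chain. *)
pose P := [set J : set R | J = set0 \/ proper_ideal_set J /\ I `<=` J].
have [F FP Ftot|m [Pm mmax]] := @Zorn_bigcup R P.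
  (* Dropping the empty set from the chain keeps the union and leaves only proper ideals containing
     [I]. *)
  pose G := [set J | F J /\ J !=set0].
  have GP J : G J -> proper_ideal_set J /\ I `<=` J.
    by case=> /FP[->|//] [x].
  have -> : \bigcup_(J in F) J = \bigcup_(J in G) J.
    apply/seteqP; split=> x [J FJ Jx]; exists J => //; last by case: FJ.
    by split=> //; exists x.
  have [->|/set0P[K GK]] := eqVneq G set0; first by left; rewrite bigcup_set0.
  right; split.
    apply: bigcup_chain_proper; first by exists K.
      by move=> J /GP [].
    by move=> J L [FJ _] [FL _]; exact: Ftot.
  by move=> x Ix; exists K => //; exact: (GP _ GK).2 x Ix.
have [m0|[properm Im]] := Pm.
  (* The empty set is not maximal in [P], since [I] is strictly larger. *)
  exfalso; apply: (mmax I); last by right; split.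
  rewrite m0; split=> [x []|I0].
  exact: I0 _ (proper_ideal0 _ _ properI).
exists m => //; split=> // J properJ mJ.
apply/seteqP; split=> //; apply: contrapT => Jm.
by apply: (mmax J) => //; right; split=> //; exact: subset_trans Im mJ.
Qed.

(** A nonunit generates a proper ideal, which lies in some maximal ideal. *)
Lemma units_notin_mSpec (R : comNzRingType) (x : R) :
  (forall m, mSpec R m -> ~ m x) -> units R x.
Proof.
move=> xm; apply: contrapT => /principal_proper/exists_maximal_ideal[m mm xRm].
by apply: (xm m mm); apply: xRm; exists 1; rewrite ?mul1r.
Qed.

Lemma semi_field_semi_inverse (R : comNzRingType) (r : R) :
  semi_field R -> exists s, forall m, mSpec R m -> m r \/ m (1 - s * r).
Proof.
move=> /(_ r)[/rho_SomeP[[S [invS /card_set_bijP[f [fS finj fsurj]]]] _]|rrad].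
  (* [S] is in bijection with a one-point set, so it is a singleton and [s] is its only element. *)
  have [s Ss _] := fsurj 0%N isT.
  exists s => m mm; have [|[s' Ss' ms']] := invS m mm; first by left.
  right; suff -> : s = s' by [].
  apply: finj; rewrite ?inE //.
  by have := fS _ Ss; have := fS _ Ss'; rewrite /=; case: (f s) (f s') => [|?] [].
(* Here [r] lies in every maximal ideal, so any [s] would do. *)
by exists 0 => m mm; left; exact: rrad.
Qed.

Lemma semi_inverse_lift_unit (R : comNzRingType) (r s t : R) :
  (forall m, mSpec R m -> m r \/ m (1 - s * r)) ->
  units R (r + (1 - s * r) * (1 - r * t)).
Proof.
move=> rs; apply: units_notin_mSpec => m mm mw; have properm := mm.1.
apply: (proper_ideal_not1 _ _ properm).
have [mr|ms] := rs m mm.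
  (* Expanding [w] shows that [1 - w] is a multiple of [r]; the coefficient is the quotient. *)
  rewrite [1](_ : _ = (r + (1 - s * r) * (1 - r * t))
                      + (s + t - s * r * t - 1) * r); last by ring.
  by apply: proper_idealD => //; exact: proper_idealM.
(* Now [s] inverts [w] modulo [1 - s * r]. *)
rewrite [1](_ : _ = s * (r + (1 - s * r) * (1 - r * t))
                    + (1 - s * (1 - r * t)) * (1 - s * r)); last by ring.
by apply: proper_idealD => //; exact: proper_idealM.
Qed.

Theorem theorem5p1 (R : comNzRingType) : semi_field R -> property_star R.
Proof.
move=> sfR S phi phi_surj u [v vu].
have [r _ ru] := phi_surj u I; have [t _ tv] := phi_surj v I.
have [s rs] := semi_field_semi_inverse _ r sfR.
exists (r + (1 - s * r) * (1 - r * t)); first exact: semi_inverse_lift_unit.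
rewrite rmorphD rmorphM !rmorphB !rmorphM rmorph1 ru tv.
by rewrite [u * v]mulrC vu subrr mulr0 addr0.
Qed.
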